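(* Let $r\in\mathbb{R}_+^m$ and $\epsilon(r)>0$, and consider testing $$H_0:\theta=0\quad\text{versus}\quad H_1:\ \|\theta\|_2\ge\epsilon(r)\ \text{ and }\ \|\theta-\hat\theta_i\|_2\le r_i\ \text{ for all } i\in[m],$$ where $r$ is known. Suppose $\operatorname{rank}\hat U\le d/2$ and $S_{\epsilon(r)}\cap B_r\neq\emptyset$. Then the hypotheses can be tested with nontrivial power if and only if $$\epsilon(r)\gtrsim\inf\Big\{\epsilon\ge0:\ n\gtrsim\frac{1}{\gamma_*^2(\epsilon,r)}\wedge\frac{\sqrt d}{\epsilon^2}\ \text{ and }\ S_\epsilon\cap B_r\ne\emptyset\Big\}.$$ That is, writing $\mathcal{I}_K(r)=\inf\{\epsilon\ge0:\ n\ge K\,(\gamma_*^{-2}(\epsilon,r)\wedge\sqrt d\,\epsilon^{-2})\text{ and }S_\epsilon\cap B_r\neq\emptyset\}$, there are positive constants $C_1,C_2,c_1,c_2$ depending only on $\alpha$ and $\beta$ such that: (i) if $\epsilon(r)\ge C_1\,\mathcal I_{C_2}(r)$, a valid and powerful test exists; (ii) if a valid and powerful test exists, then $\epsilon(r)\ge c_1\,\mathcal I_{c_2}(r)$.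
   Context: $d,n,m\ge1$ are integers and $\hat\theta_1,\dots,\hat\theta_m\in\mathbb{R}^d$ are fixed nonzero vectors (predictions). One observes $X\sim P_\theta=\mathcal N(\theta,I_d/n)$ with unknown $\theta\in\mathbb{R}^d$. Fix $\alpha\in(0,1)$, $\beta\in(0,1-\alpha)$. A test is a measurable $\psi:\mathbb{R}^d\to\{0,1\}$ (here it may depend on $d,n$, the predictions, $r$, $\epsilon(r)$, $\alpha$); it is valid if $P_0(\psi(X)=1)\le\alpha$. A valid test is powerful if $\sup P_\theta(\psi(X)=0)<\beta$, the supremum being over all $\theta$ in the alternative $H_1$. ''Can be tested with nontrivial power'' means that a valid and powerful test exists. $S_\epsilon=\{\theta:\|\theta\|_2=\epsilon\}$; $B_r=\bigcap_{i=1}^m\{\theta:\|\theta-\hat\theta_i\|_2\le r_i\}$; $\hat U\in\mathbb{R}^{d\times m}$ has columns $\hat u_i=\hat\theta_i/\|\hat\theta_i\|_2$; $\Pi_{\hat U}$ is the orthogonal projection onto the column span of $\hat U$; $\gamma_*^2(\epsilon,r)=\inf_{\theta\in S_\epsilon\cap B_r}\|\Pi_{\hat U}\theta\|_2^2$. $a\wedge b=\min(a,b)$, $1/0=+\infty$, $\inf\emptyset=+\infty$. *)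

(* Defs.v *)
From HB Require Import structures.
From mathcomp Require Import all_boot all_order all_algebra.
From mathcomp Require Import all_classical all_reals all_analysis.

Set Implicit Arguments.
Unset Strict Implicit.
Unset Printing Implicit Defensive.

Import Order.TTheory GRing.Theory Num.Theory.
Import numFieldNormedType.Exports.

Local Open Scope classical_set_scope.
Local Open Scope ring_scope.

Definition measure_cV_display : measure_display -> measure_display.
Proof. exact. Qed.

Section measurable_cV.
Context {d : measure_display} {T : measurableType d}.
Variable n : nat.

Let coord (i : 'I_n) (v : 'cV[T]_n) : T := v i ord0.

Let cV_set0 : g_sigma_preimage coord set0.
Proof. exact: sigma_algebra0. Qed.

Let cV_setC A : g_sigma_preimage coord A -> g_sigma_preimage coord (~` A).
Proof. exact: sigma_algebraC. Qed.

Let cV_bigcup (F : (set 'cV[T]_n)^nat) :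
  (forall i, g_sigma_preimage coord (F i)) ->
  g_sigma_preimage coord (\bigcup_i F i).
Proof. exact: sigma_algebra_bigcup. Qed.

(* The product sigma-algebra, generated by the coordinates; over T = R it is
   the Borel sigma-algebra of R^n. *)
HB.instance Definition _ := @isMeasurable.Build (measure_cV_display d)
  'cV[T]_n (g_sigma_preimage coord) cV_set0 cV_setC cV_bigcup.

End measurable_cV.

Lemma measurable_fun_cVP d1 d2 (T1 : measurableType d1) (T2 : measurableType d2)
    n (f : T1 -> 'cV[T2]_n) :
  measurable_fun [set: T1] f <->
  forall i, measurable_fun [set: T1] (fun x => f x i ord0).
Proof.
split=> [mf i _ A mA|mf].
  rewrite setTI.
  have : measurable ([set v : 'cV[T2]_n | A (v i ord0)]).
    apply: sub_sigma_algebra; rewrite -bigcup_seq/=.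
    by exists i => /=; [rewrite mem_index_enum|exists A => //; rewrite setTI].
  by move=> /(mf measurableT); rewrite setTI.
suff : @measurable _ 'cV[T2]_n `<=` [set A | measurable (f @^-1` A)].
  by move=> mf' _ A mA; rewrite setTI; exact: mf'.
apply: smallest_sub.
  split => /=.
  - by rewrite preimage_set0.
  - by move=> A mA; rewrite setTD preimage_setC; exact: measurableC.
  - by move=> F mF; rewrite preimage_bigcup; exact: bigcup_measurable.
move=> A; rewrite -bigcup_seq/= => -[i _ [B mB <-]] /=.
by rewrite setTI; have := mf i measurableT B mB; rewrite setTI.
Qed.

Lemma measurable_cV_coord d (T : measurableType d) n (i : 'I_n) :
  measurable_fun [set: 'cV[T]_n] (fun v => v i ord0).
Proof. by move: i; apply/measurable_fun_cVP; exact: measurable_id. Qed.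

Section cV_cons.
Context {d : measure_display} {T : measurableType d} {n : nat}.

Definition cV_cons (xv : T * 'cV[T]_n) : 'cV[T]_n.+1 :=
  \col_i oapp (fun j => xv.2 j ord0) xv.1 (unlift ord0 i).

Lemma measurable_cV_cons : measurable_fun [set: T * 'cV[T]_n] cV_cons.
Proof.
apply/measurable_fun_cVP => i.
have [->|[j ->]] : i = ord0 \/ exists j, i = lift ord0 j.
  by case: (unliftP ord0 i) => [j ->|->]; [right; exists j|left].
- apply: (eq_measurable_fun fst) => // x _.
  by rewrite mxE unlift_none.
- apply: (eq_measurable_fun ((fun v : 'cV[T]_n => v j ord0) \o snd)).
    by move=> x _; rewrite mxE liftK.
  by apply: measurableT_comp => //; exact: measurable_cV_coord.
Qed.

HB.instance Definition _ :=
  isMeasurableFun.Build _ _ _ _ cV_cons measurable_cV_cons.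

End cV_cons.

(* The product P_0 \x ... \x P_(n-1) transported to column vectors; cV_prodE
   gives its value on boxes. *)
Fixpoint cV_prod {d : measure_display} {T : measurableType d} {R : realType}
    (n : nat) : ('I_n -> probability T R) -> probability 'cV[T]_n R :=
  if n is n'.+1 then
    fun P => distribution (P ord0 \x cV_prod (fun i => P (lift ord0 i)))%E
                          cV_cons
  else fun=> dirac (\col_i point).

Lemma cV_prodE d (T : measurableType d) (R : realType) n
    (P : 'I_n -> probability T R) (A : 'I_n -> set T) :
  (forall i, measurable (A i)) ->
  cV_prod P [set v | forall i, A i (v i ord0)] = (\prod_(i < n) P i (A i))%E.
Proof.
elim: n P A => [|n IHn] P A mA /=.
  by rewrite big_ord0 diracE mem_set//; case.
rewrite big_ord_recl -IHn//.
rewrite /distribution /pushforward.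
have mtail : measurable [set v : 'cV[T]_n | forall i, A (lift ord0 i) (v i ord0)].
  rewrite (_ : mkset _ = \big[setI/setT]_(i < n)
      [set v : 'cV[T]_n | A (lift ord0 i) (v i ord0)]); last first.
    by rewrite -bigcap_seq; apply/seteqP; split=> [v Av i _|v Av i];
      [exact: Av|apply: Av; rewrite /= mem_index_enum].
  apply: bigsetI_measurable => i _; rewrite -[X in measurable X]setTI.
  exact: measurable_cV_coord.
rewrite -product_measure1E//.
congr (product_measure1 _ _ _); apply/seteqP; split=> -[x v] /=.
  move=> Axv; split=> [|i]; first by have := Axv ord0; rewrite mxE unlift_none.
  by have := Axv (lift ord0 i); rewrite mxE liftK.
move=> [Ax Av] i; rewrite mxE.
by case: unliftP => [j ->|->] /=; [exact: Av|].
Qed.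

Section normal_probR.
Context {R : realType}.
Variables m sigma : R.

(* normal_prob lives on measurableTypeR R, which has the same carrier and the
   same measurable sets as R but another display. *)
Definition normal_probR : set R -> \bar R := normal_prob m sigma.

Let normal_probR0 : normal_probR set0 = 0%E.
Proof. exact: measure0. Qed.

Let normal_probR_ge0 A : (0 <= normal_probR A)%E.
Proof. exact: (measure_ge0 (normal_prob m sigma)). Qed.

Let normal_probR_sigma_additive : semi_sigma_additive normal_probR.
Proof. exact: (@measure_semi_sigma_additive _ _ _ (normal_prob m sigma)). Qed.

HB.instance Definition _ := isMeasure.Build _ R R normal_probR
  normal_probR0 normal_probR_ge0 normal_probR_sigma_additive.

Let normal_probRT : normal_probR [set: R] = 1%E.
Proof. exact: (probability_setT (normal_prob m sigma)). Qed.

HB.instance Definition _ :=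
  @Measure_isProbability.Build _ R R normal_probR normal_probRT.

End normal_probR.

(* N(theta, sigma^2 I_d): sigma is the standard deviation. *)
Definition gauss {R : realType} {d : nat} (theta : 'cV[R]_d) (sigma : R) :
    probability 'cV[R]_d R :=
  cV_prod (fun i => normal_probR (theta i ord0) sigma).

Section geometry.
Context {R : realType} {d : nat}.
Implicit Types (theta : 'cV[R]_d) (epsilon : R).

(* The norm `| x | that the library puts on matrices is the sup norm. *)
Definition norm2 theta : R := Num.sqrt (\sum_(i < d) theta i ord0 ^+ 2).

Definition sphere epsilon : set 'cV[R]_d := [set theta | norm2 theta = epsilon].

(* The row space of kermx U is the orthogonal complement of the column span of
   U. *)
Definition col_proj {m : nat} (U : 'M[R]_(d, m)) theta : 'cV[R]_d :=
  (theta^T *m proj_mx <<U^T>>%MS (kermx U))^T.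

Context {m : nat}.
Variables (thetahat : 'I_m -> 'cV[R]_d) (r : 'I_m -> R).

Definition balls : set 'cV[R]_d :=
  [set theta | forall i, norm2 (theta - thetahat i) <= r i].

Definition Uhat : 'M[R]_(d, m) :=
  \matrix_(k, i) ((norm2 (thetahat i))^-1 *: thetahat i) k ord0.

Definition gamma2 epsilon : \bar R :=
  ereal_inf [set (norm2 (col_proj Uhat theta) ^+ 2)%:E |
             theta in sphere epsilon `&` balls].

(* Inverses are taken in \bar R, where 0^-1 = +oo; ereal_inf set0 = +oo. *)
Definition rate_inf (n : nat) (K : R) : \bar R :=
  ereal_inf [set epsilon%:E | epsilon in [set epsilon : R |
    [/\ 0 <= epsilon,
        (K%:E * Order.min (gamma2 epsilon)^-1
                          ((Num.sqrt d%:R)%:E * ((epsilon ^+ 2)%:E)^-1)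
         <= (n%:R)%:E)%E
      & sphere epsilon `&` balls !=set0]]].

Definition alternative epsilon : set 'cV[R]_d :=
  [set theta | epsilon <= norm2 theta] `&` balls.

Definition valid_test (n : nat) (alpha : R) (psi : 'cV[R]_d -> bool) : Prop :=
  measurable_fun [set: 'cV[R]_d] psi /\
  (gauss 0 (Num.sqrt n%:R)^-1 (psi @^-1` [set true]) <= alpha%:E)%E.

Definition powerful_test (n : nat) (epsilon beta : R) (psi : 'cV[R]_d -> bool) :
    Prop :=
  (ereal_sup [set gauss theta (Num.sqrt n%:R)^-1 (psi @^-1` [set false]) |
              theta in alternative epsilon] < beta%:E)%E.

Definition testable (n : nat) (epsilon alpha beta : R) : Prop :=
  exists psi, valid_test n alpha psi /\ powerful_test n epsilon beta psi.

End geometry.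

Section col_proj_theory.
Context {R : realType} {d m : nat}.
Variable U : 'M[R]_(d, m).

Let cap0 : (<<U^T>> :&: kermx U)%MS = 0.
Proof.
apply/eqP/rowV0P => v; rewrite sub_capmx genmxE => /andP[/submxP[w ->]].
move=> /sub_kermxP wU; set u := w *m U^T in wU *.
have : (u *m u^T) ord0 ord0 = 0.
  by rewrite {2}/u trmx_mul trmxK mulmxA wU mul0mx mxE.
move: u {wU} => u; rewrite mxE (eq_bigr (fun j => u ord0 j ^+ 2)); last first.
  by move=> j _; rewrite mxE expr2.
move=> /eqP; rewrite psumr_eq0/=; last by move=> j _; rewrite sqr_ge0.
move=> /allP u0; apply/rowP => i; rewrite [RHS]mxE; apply/eqP.
by rewrite -sqrf_eq0; apply: u0; rewrite mem_index_enum.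
Qed.

Let add1 (v : 'rV[R]_d) : (v <= <<U^T>> + kermx U)%MS.
Proof.
apply: submx_full; rewrite /row_full mxrank_disjoint_sum//.
by rewrite genmxE mxrank_tr mxrank_ker subnKC// rank_leq_row.
Qed.

Lemma col_proj_sub theta : exists w : 'cV[R]_m, col_proj U theta = U *m w.
Proof.
have /submxP[w w_def] : (theta^T *m proj_mx <<U^T>>%MS (kermx U) <= U^T)%MS.
  by rewrite (submx_trans (proj_mx_sub _ _ _))// genmxE.
by exists w^T; rewrite /col_proj w_def trmx_mul trmxK.
Qed.

Lemma col_proj_orthogonal theta : U^T *m (theta - col_proj U theta) = 0.
Proof.
apply: trmx_inj; rewrite trmx_mul trmxK trmx0 linearB/= trmxK.
rewrite -{1}(add_proj_mx cap0 (add1 theta^T)) addrC addKr.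
exact/sub_kermxP/proj_mx_sub.
Qed.

End col_proj_theory.

(* Main.v *)
Require Import Defs.
From mathcomp Require Import all_boot all_order all_algebra.
From mathcomp Require Import all_classical all_reals all_analysis.
From mathcomp Require Import measurable_realfun.
From mathcomp Require Import ring lra.

Set Implicit Arguments.
Unset Strict Implicit.
Unset Printing Implicit Defensive.

Import Order.TTheory GRing.Theory Num.Theory.
Import numFieldNormedType.Exports.

Local Open Scope classical_set_scope.
Local Open Scope ring_scope.

(** Write N = n, U for the matrix of directions and [dot] for the Euclidean
inner product.  Expanding the square, the constraint of the i-th ball on a
vector of norm e is the linear inequality
  2 <thetahat_i, theta> >= e^2 + |thetahat_i|^2 - r_i^2,
so membership in the balls depends only on the norm of theta and on its
projection on the span of the predictions.  Both directions of the theorem use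
this.

Tests.  Every theta of the alternative with |theta| >= e lies in the polyhedron
of these inequalities.  Let q be its point of least norm.  By convexity
<q, theta> >= |q|^2 on the whole polyhedron, and since the directions orthogonal
to the predictions are free, the projection of q can be completed to a vector of
norm e in the balls, which gives gamma_*^2(e, r) <= |q|^2
([alternative_separated]).  If N gamma_*^2 is large the likelihood ratio test in
the direction q therefore works, whatever the dimension ([testable_linear]).  If
N e^2 / sqrt d is large the chi-square test works ([testable_chi2]).  Both are
analysed by a Chernoff bound, for which only two Gaussian exponential moments
are needed.

Lower bound.  Suppose that N gamma_*^2(epsilon) and N epsilon^2 / sqrt d are
both below a small c.  Take theta in the balls with |theta| = epsilon and with
projection p of nearly least norm, and an orthonormal system W of k >= d / 2
vectors orthogonal to the predictions.  For signs s in {-1, 1}^k, the vectors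
p + a W^T s, where a is chosen so that their norm is epsilon, all lie in the
alternative.  The second moment under N(0, I / N) of the likelihood ratio of
their uniform mixture is
  exp (N |p|^2) (cosh (N a^2))^k <= exp (N |p|^2 + 2 k (N a^2)^2) <= 1 + 4 c,
so the mixture is too close to the null for a test to have both errors small
([mixture_power_le], [not_testable]).

All Gaussian computations come from one fact: a product measure whose factors
have densities with respect to other factors has the product density
([ge0_integral_cV_prod_change]).  Completing the square then yields the
exponential moments as well as the likelihood ratios. *)

(** * Change of measure for normal laws and products *)

(** The density in the definition of the normal law is only known there on sets.
Integrals of functions transfer through the Radon-Nikodym derivative, which
coincides with that density almost everywhere. *)
Lemma ge0_integral_normal_prob (R : realType) (m s : R)
    (g : measurableTypeR R -> \bar R) :
  measurable_fun setT g -> (forall x, 0 <= g x)%E ->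
  (\int[normal_prob m s]_x g x =
   \int[lebesgue_measure]_x (g x * (normal_pdf m s x)%:E))%E.
Proof.
move=> mg g0; have dom := normal_prob_dominates m s.
set f := Radon_Nikodym_SigmaFinite.f (normal_prob m s) lebesgue_measure.
have intf : lebesgue_measure.-integrable setT f.
  exact: Radon_Nikodym_SigmaFinite.f_integrable.
have mf := measurable_int _ intf.
have mpdf : measurable_fun [set: measurableTypeR R]
    (fun x => (normal_pdf m s x)%:E).
  by apply/measurable_EFinP; exact: measurable_normal_pdf.
rewrite -(Radon_Nikodym_SigmaFinite.change_of_variables dom g0)//.
have f_pdf : ae_eq lebesgue_measure setT f (fun x => (normal_pdf m s x)%:E).
  apply: integral_ae_eq => // A _ mA.
  by rewrite -Radon_Nikodym_SigmaFinite.f_integral.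
apply: ge0_ae_eq_integral => //.
- exact: emeasurable_funM.
- exact: emeasurable_funM.
- by move=> x _; rewrite mule_ge0// Radon_Nikodym_SigmaFinite.f_ge0.
- by move=> x _; rewrite mule_ge0// lee_fin normal_pdf_ge0.
- exact: ae_eqe_mul2l.
Qed.

(** The identity map carries the normal law from the display on which it is defined
to the one used for vectors. *)
Lemma ge0_integral_normal_probR (R : realType) (m s : R) (g : R -> \bar R) :
  measurable_fun [set: R] g -> (forall x, 0 <= g x)%E ->
  (\int[normal_probR m s]_x g x =
   \int[lebesgue_measure]_x ((g : measurableTypeR R -> \bar R) x *
                             (normal_pdf m s x)%:E))%E.
Proof.
move=> mg g0; rewrite -ge0_integral_normal_prob//.
have mid : measurable_fun [set: measurableTypeR R] (fun x : measurableTypeR R => (x : R)).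
  by [].
exact: (ge0_integral_pushforward mid (normal_prob m s) measurableT mg).
Qed.

Lemma normal_pdf_change (R : realType) (m s m' s' x : R) : 0 < s -> 0 < s' ->
  normal_pdf m' s' x =
  s / s' * expR ((x - m) ^+ 2 / (s ^+ 2 *+ 2) - (x - m') ^+ 2 / (s' ^+ 2 *+ 2))
    * normal_pdf m s x.
Proof.
move=> s0 s'0; rewrite !normal_pdfE ?gt_eqF// /normal_peak /normal_fun.
have peakE (t : R) : 0 < t -> Num.sqrt (t ^+ 2 * pi *+ 2) = t * Num.sqrt (pi *+ 2).
  by move=> t0; rewrite -mulrnAr sqrtrM ?sqr_ge0// sqrtr_sqr gtr0_norm.
rewrite !peakE// expRD !mulNr !expRN.
have P0 : Num.sqrt (pi *+ 2) != 0 :> R.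
  by rewrite gt_eqF// sqrtr_gt0 mulrn_wgt0// pi_gt0.
have := gt_eqF (expR_gt0 ((x - m) ^+ 2 / (s ^+ 2 *+ 2))).
have := gt_eqF (expR_gt0 ((x - m') ^+ 2 / (s' ^+ 2 *+ 2))).
set A := expR _; set B := expR _ => A0 B0.
by field; rewrite A0 B0 P0 !gt_eqF.
Qed.

Lemma ge0_integral_normal_probR_change (R : realType) (m s m' s' : R)
    (g : R -> \bar R) : 0 < s -> 0 < s' ->
  measurable_fun [set: R] g -> (forall x, 0 <= g x)%E ->
  (\int[normal_probR m' s']_x g x =
   \int[normal_probR m s]_x (g x * (s / s' *
     expR ((x - m) ^+ 2 / (s ^+ 2 *+ 2) - (x - m') ^+ 2 / (s' ^+ 2 *+ 2)))%:E))%E.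
Proof.
move=> s0 s'0 mg g0; rewrite !ge0_integral_normal_probR//.
- apply: eq_integral => x _.
  by rewrite (normal_pdf_change m m' x s0 s'0) EFinM muleA.
- apply: emeasurable_funM => //; apply/measurable_EFinP.
  apply: measurable_funM => //; apply: measurableT_comp => //.
  by apply: measurable_funB => //; apply: measurable_funM => //;
     apply: measurable_funX; apply: measurable_funB.
- by move=> x; rewrite mule_ge0// lee_fin mulr_ge0 ?expR_ge0// divr_ge0 ?ltW.
Qed.

Lemma measurable_cV_prod d (T : measurableType d) (R : realType) n
    (f : 'I_n -> T -> R) : (forall i, measurable_fun setT (f i)) ->
  measurable_fun [set: 'cV[T]_n] (fun v => \prod_i f i (v i ord0)).
Proof.
move=> mf; apply: measurable_prod => i _.
by apply: measurableT_comp => //; exact: measurable_cV_coord.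
Qed.

(** Induction on the dimension: Tonelli isolates the first coordinate, the
induction hypothesis changes the inner measure and the remaining factor changes
the outer one. *)
Lemma ge0_integral_cV_prod_change d (T : measurableType d) (R : realType) n
    (P Q : 'I_n -> probability T R) (f : 'I_n -> T -> R) :
  (forall i, measurable_fun setT (f i)) -> (forall i x, 0 <= f i x) ->
  (forall i (g : T -> \bar R), measurable_fun setT g -> (forall x, 0 <= g x)%E ->
    (\int[P i]_x g x = \int[Q i]_x (g x * (f i x)%:E))%E) ->
  forall g : 'cV[T]_n -> \bar R,
    measurable_fun setT g -> (forall v, 0 <= g v)%E ->
  (\int[cV_prod P]_v g v =
   \int[cV_prod Q]_v (g v * (\prod_i f i (v i ord0))%:E))%E.
Proof.
elim: n P Q f => [|n IH] P Q f mf f0 PQ g mg g0 /=.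
  by apply: eq_integral => v _; rewrite big_ord0 mule1.
have mF := measurable_cV_prod mf.
have mgF : measurable_fun setT
    (fun v : 'cV[T]_n.+1 => g v * (\prod_i f i (v i ord0))%:E)%E.
  by apply: emeasurable_funM => //; exact/measurable_EFinP.
have gF0 v : (0 <= g v * (\prod_i f i (v i ord0))%:E)%E.
  by rewrite mule_ge0// lee_fin prodr_ge0.
have mgc : measurable_fun setT (g \o @cV_cons _ T n).
  by apply: measurableT_comp => //; exact: measurable_cV_cons.
pose h (xv : T * 'cV[T]_n) :=
  (g (cV_cons xv) * (\prod_i f (lift ord0 i) (xv.2 i ord0))%:E)%E.
have mh : measurable_fun setT h.
  apply: emeasurable_funM => //; apply/measurable_EFinP.
  have mFl := measurable_cV_prod (fun i => mf (lift ord0 i)).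
  exact: (measurableT_comp mFl measurable_snd).
have h0 xv : (0 <= h xv)%E by rewrite mule_ge0// lee_fin prodr_ge0.
have cons0 x v : @cV_cons _ T n (x, v) ord0 ord0 = x by rewrite mxE unlift_none.
have consS x v i : @cV_cons _ T n (x, v) (lift ord0 i) ord0 = v i ord0.
  by rewrite mxE liftK.
have gFE x v : (g (cV_cons (x, v)) * (\prod_i f i (cV_cons (x, v) i ord0))%:E)%E =
    (h (x, v) * (f ord0 x)%:E)%E.
  rewrite big_ord_recl cons0 /h/= mulrC EFinM muleA; congr (_ * _%:E * _)%E.
  by apply: eq_bigr => i _; rewrite consS.
have mgFc := measurableT_comp mgF (@measurable_cV_cons _ T n).
rewrite !ge0_integral_distribution//.
rewrite (fubini_tonelli1 _ mgc (fun xv => g0 _)).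
rewrite (fubini_tonelli1 _ mgFc (fun xv => gF0 _)) /fubini_F.
transitivity (\int[P ord0]_x \int[cV_prod (fun i => Q (lift ord0 i))]_v h (x, v))%E.
  apply: eq_integral => x _.
  apply: (IH _ (fun i => Q (lift ord0 i)) (fun i => f (lift ord0 i)) _ _ _
    (fun v => g (cV_cons (x, v)))) => //.
  + by move=> i; exact: PQ.
  + exact: (measurableT_comp mgc (pair1_measurable x)).
rewrite PQ//; first last.
- by move=> x; exact: integral_ge0.
- exact: (measurable_fun_fubini_tonelli_F h).
apply: eq_integral => x _; rewrite -ge0_integralZr//.
- by apply: eq_integral => v _; rewrite /= gFE.
- exact: (measurableT_comp mh (pair1_measurable x)).
- by rewrite lee_fin.
Qed.

(** * The Euclidean inner product *)

Definition dot (R : realType) d (u v : 'cV[R]_d) : R :=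
  \sum_(i < d) u i ord0 * v i ord0.

Lemma dotC (R : realType) d (u v : 'cV[R]_d) : dot u v = dot v u.
Proof. by apply: eq_bigr => i _; rewrite mulrC. Qed.

Lemma dotDr (R : realType) d (u v w : 'cV[R]_d) : dot u (v + w) = dot u v + dot u w.
Proof. by rewrite -big_split; apply: eq_bigr => i _; rewrite mxE mulrDr. Qed.

Lemma dotDl (R : realType) d (u v w : 'cV[R]_d) : dot (v + w) u = dot v u + dot w u.
Proof. by rewrite !(dotC _ u) dotDr. Qed.

Lemma dotZr (R : realType) d a (u v : 'cV[R]_d) : dot u (a *: v) = a * dot u v.
Proof. by rewrite mulr_sumr; apply: eq_bigr => i _; rewrite mxE mulrCA. Qed.

Lemma dotZl (R : realType) d a (u v : 'cV[R]_d) : dot (a *: v) u = a * dot v u.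
Proof. by rewrite !(dotC _ u) dotZr. Qed.

Lemma dotNr (R : realType) d (u v : 'cV[R]_d) : dot u (- v) = - dot u v.
Proof. by rewrite -scaleN1r dotZr mulN1r. Qed.

Lemma dotNl (R : realType) d (u v : 'cV[R]_d) : dot (- v) u = - dot v u.
Proof. by rewrite !(dotC _ u) dotNr. Qed.

Lemma dot0r (R : realType) d (u : 'cV[R]_d) : dot u 0 = 0.
Proof. by rewrite -(scale0r 0) dotZr mul0r. Qed.

Lemma dot_ge0 (R : realType) d (u : 'cV[R]_d) : 0 <= dot u u.
Proof. by apply: sumr_ge0 => i _; rewrite -expr2 sqr_ge0. Qed.

Lemma dot_eq0 (R : realType) d (u : 'cV[R]_d) : (dot u u == 0) = (u == 0).
Proof.
apply/eqP/eqP => [u0|->]; last exact: dot0r.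
apply/colP => i; rewrite [RHS]mxE; apply/eqP; rewrite -sqrf_eq0 expr2; apply/eqP.
by move/psumr_eq0P: u0; apply => // j _; rewrite -expr2 sqr_ge0.
Qed.

Lemma norm2_sqr (R : realType) d (u : 'cV[R]_d) : norm2 u ^+ 2 = dot u u.
Proof.
rewrite /norm2 sqr_sqrtr; last by apply: sumr_ge0 => i _; rewrite sqr_ge0.
by apply: eq_bigr => i _; rewrite expr2.
Qed.

Lemma norm2_ge0 (R : realType) d (u : 'cV[R]_d) : 0 <= norm2 u.
Proof. exact: sqrtr_ge0. Qed.

Lemma norm2_le (R : realType) d (u : 'cV[R]_d) (a : R) : 0 <= a ->
  (norm2 u <= a) = (dot u u <= a ^+ 2).
Proof. by move=> a0; rewrite -norm2_sqr ler_pXn2r// nnegrE norm2_ge0. Qed.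

(** * Exponential moments of Gaussian vectors *)

Lemma measurable_dot (R : realType) d (u : 'cV[R]_d) :
  measurable_fun [set: 'cV[R]_d] (dot u).
Proof.
apply: measurable_sum => i; apply: measurable_funM => //.
exact: measurable_cV_coord.
Qed.

Lemma measurable_dot2 (R : realType) d :
  measurable_fun [set: 'cV[R]_d] (fun x => dot x x).
Proof.
by apply: measurable_sum => i; apply: measurable_funM; exact: measurable_cV_coord.
Qed.

(** The source of all Gaussian identities below: applied to a constant, it gives
the integral of the exponential of any quadratic function of this form. *)
Lemma ge0_integral_gauss_change (R : realType) d (theta theta' : 'cV[R]_d) (s s' : R)
    (g : 'cV[R]_d -> \bar R) : 0 < s -> 0 < s' ->
  measurable_fun setT g -> (forall x, 0 <= g x)%E ->
  (\int[gauss theta' s']_x g x =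
   \int[gauss theta s]_x (g x * ((s / s') ^+ d *
     expR (dot (x - theta) (x - theta) / (s ^+ 2 *+ 2) -
           dot (x - theta') (x - theta') / (s' ^+ 2 *+ 2)))%:E))%E.
Proof.
move=> s0 s'0 mg g0.
pose f i x := s / s' * expR ((x - theta i ord0) ^+ 2 / (s ^+ 2 *+ 2) -
                             (x - theta' i ord0) ^+ 2 / (s' ^+ 2 *+ 2)).
have fE (x : 'cV[R]_d) : \prod_i f i (x i ord0) = (s / s') ^+ d *
     expR (dot (x - theta) (x - theta) / (s ^+ 2 *+ 2) -
           dot (x - theta') (x - theta') / (s' ^+ 2 *+ 2)).
  rewrite big_split/= prodr_const card_ord -expR_sum; congr (_ * expR _).
  rewrite sumrB -!mulr_suml; congr (_ / _ - _ / _);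
    by apply: eq_bigr => i _; rewrite !mxE expr2.
under [RHS]eq_integral => x _ do rewrite -fE.
apply: (@ge0_integral_cV_prod_change _ _ _ d (fun i => normal_probR (theta' i ord0) s')
  (fun i => normal_probR (theta i ord0) s) f _ _ _ g mg g0).
- move=> i.
  apply: measurable_funM => //; apply: measurableT_comp => //.
  by apply: measurable_funB => //; apply: measurable_funM => //;
     apply: measurable_funX; apply: measurable_funB.
- by move=> i x; rewrite mulr_ge0 ?expR_ge0// divr_ge0 ?ltW.
- by move=> i h mh h0; exact: ge0_integral_normal_probR_change.
Qed.

Lemma sqr_invr_sqrt (R : realType) (n : nat) :
  (Num.sqrt n%:R : R)^-1 ^+ 2 = n%:R^-1.
Proof. by rewrite exprVn sqr_sqrtr. Qed.

Lemma invr_sqrt_gt0 (R : realType) (n : nat) : (0 < n)%N ->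
  0 < (Num.sqrt n%:R : R)^-1.
Proof. by move=> n0; rewrite invr_gt0 sqrtr_gt0 ltr0n. Qed.

Lemma ge0_integral_gauss_shift (R : realType) d n (theta eta : 'cV[R]_d)
    (g : 'cV[R]_d -> \bar R) : (0 < n)%N ->
  measurable_fun setT g -> (forall x, 0 <= g x)%E ->
  (\int[gauss (theta + eta) (Num.sqrt n%:R)^-1]_x g x =
   \int[gauss theta (Num.sqrt n%:R)^-1]_x (g x *
     (expR (n%:R * dot eta (x - theta) - n%:R / 2 * dot eta eta))%:E))%E.
Proof.
move=> n0 mg g0; have s0 := invr_sqrt_gt0 R n0.
etransitivity; first exact: (ge0_integral_gauss_change theta (theta + eta) s0 s0 mg g0).
apply: eq_integral => x _; rewrite divff ?gt_eqF// expr1n mul1r.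
congr (_ * (expR _)%:E)%E; rewrite sqr_invr_sqrt opprD addrA.
rewrite !(dotDl, dotDr, dotNl, dotNr) (dotC x eta) (dotC theta eta).
by field; rewrite pnatr_eq0 -lt0n.
Qed.

Lemma integral_probability_cst d (T : measurableType d) (R : realType)
    (P : probability T R) (c : \bar R) : (\int[P]_x c = c)%E.
Proof. by rewrite integral_cst// [X in (c * X)%E](@probability_setT _ _ _ P) mule1. Qed.

(** The integrand is, up to a constant, the density of the Gaussian translated by
eta. *)
Lemma gauss_mgf_linear (R : realType) d n (theta eta : 'cV[R]_d) : (0 < n)%N ->
  (\int[gauss theta (Num.sqrt n%:R)^-1]_x (expR (n%:R * dot eta x))%:E =
   (expR (n%:R * dot eta theta + n%:R / 2 * dot eta eta))%:E)%E.
Proof.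
move=> n0; set C := (expR (_ + _))%:E.
apply/esym; apply: etrans (esym (integral_probability_cst
  (gauss (theta + eta) (Num.sqrt n%:R)^-1) C)) _.
apply: etrans (ge0_integral_gauss_shift theta eta n0
  (measurable_cst C) (fun=> expR_ge0 _)) _.
apply: eq_integral => x _; rewrite -EFinM -expRD dotDr dotNr.
by congr (expR _)%:E; ring.
Qed.

(** Completing the square, the integrand is, up to a constant, the density of the
Gaussian of mean theta / (1 - c) and variance 1 / (n (1 - c)). *)
Lemma gauss_mgf_quadratic (R : realType) d n (c : R) (theta : 'cV[R]_d) :
  (0 < n)%N -> c < 1 ->
  (\int[gauss theta (Num.sqrt n%:R)^-1]_x (expR (n%:R / 2 * c * dot x x))%:E =
   ((Num.sqrt (1 - c)) ^- d *
      expR (n%:R / 2 * (c / (1 - c)) * dot theta theta))%:E)%E.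
Proof.
move=> n0 c1; set C := (_ * _)%:E; have s0 := invr_sqrt_gt0 R n0.
have q0 : 0 < Num.sqrt (1 - c) by rewrite sqrtr_gt0 subr_gt0.
have s'0 := divr_gt0 s0 q0.
have C0 : (0 <= C)%E by rewrite lee_fin mulr_ge0 ?expR_ge0// invr_ge0 exprn_ge0// ltW.
apply/esym; apply: etrans (esym (integral_probability_cst
  (gauss ((1 - c)^-1 *: theta) ((Num.sqrt n%:R)^-1 / Num.sqrt (1 - c))) C)) _.
apply: etrans (ge0_integral_gauss_change theta ((1 - c)^-1 *: theta) s0 s'0
  (measurable_cst C) (fun=> C0)) _.
apply: eq_integral => x _; rewrite -EFinM invf_div.
rewrite [X in _ * (X ^+ d * _)]mulrC divfK ?gt_eqF// mulrACA mulVf ?gt_eqF ?exprn_gt0//.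
rewrite mul1r -expRD; congr (expR _)%:E.
rewrite exprMn sqr_invr_sqrt exprVn sqr_sqrtr ?subr_ge0 ?ltW//.
rewrite !(dotDl, dotDr, dotNl, dotNr, dotZr, dotZl) (dotC x theta).
have c0 : 1 - c != 0 by rewrite gt_eqF// subr_gt0.
by field; rewrite c0 pnatr_eq0 -lt0n.
Qed.

(** * Two tests *)

(** Markov's inequality, normalised to the threshold 1. *)
Lemma measure_le_integral d (T : measurableType d) (R : realType)
    (mu : {measure set T -> \bar R}) (A : set T) (h : T -> R) :
  measurable A -> measurable_fun setT h -> (forall x, 0 <= h x) ->
  (forall x, A x -> 1 <= h x) -> (mu A <= \int[mu]_x (h x)%:E)%E.
Proof.
move=> mA mh h0 h1; rewrite -[X in (mu X <= _)%E]setIT -integral_indic//.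
apply: ge0_le_integral => //.
- exact/measurable_EFinP/measurable_indic.
- exact/measurable_EFinP.
move=> x _; rewrite lee_fin indicE; case: (boolP (x \in A)) => // /set_mem.
exact: h1.
Qed.

(** Chernoff bounds for the test that rejects when S is at least t, with exponent 1
on both sides; a scale is absorbed in S. *)
Lemma testable_of_chernoff (R : realType) d m (thetahat : 'I_m -> 'cV[R]_d)
    (r : 'I_m -> R) n (epsilon alpha beta : R) (S : 'cV[R]_d -> R) (t b : R) :
  measurable_fun setT S -> b < beta ->
  (\int[gauss 0 (Num.sqrt n%:R)^-1]_x (expR (S x))%:E <= (alpha * expR t)%:E)%E ->
  (forall theta, alternative thetahat r epsilon theta ->
    (\int[gauss theta (Num.sqrt n%:R)^-1]_x (expR (- S x))%:E
      <= (b * expR (- t))%:E)%E) ->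
  testable thetahat r n epsilon alpha beta.
Proof.
move=> mS bbeta H0 H1; exists (fun x => t <= S x).
have mpsi : measurable_fun setT (fun x => t <= S x) by exact: measurable_fun_ler.
have mpre (b' : bool) : measurable ((fun x => t <= S x) @^-1` [set b']).
  by rewrite -[X in measurable X]setTI; exact: mpsi.
have mexp (F : 'cV[R]_d -> R) : measurable_fun setT F ->
    measurable_fun setT (fun x => expR (F x)).
  by move=> mF; exact: measurableT_comp.
have mSN : measurable_fun setT (fun x => - S x) by exact: measurableT_comp.
split; first split => //.
  apply: le_trans (measure_le_integral
    (h := fun x => expR (S x) * expR (- t)) _ _ _ _ _) _ => //.
  - by apply: measurable_funM => //; exact: mexp.
  - by move=> x /= tS; rewrite -expRD -[leLHS]expR0 ler_expR subr_ge0.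
  under eq_integral do rewrite EFinM.
  rewrite ge0_integralZr//.
  - by rewrite expRN lee_pdivrMr ?expR_gt0.
  - by apply/measurable_EFinP; exact: mexp.
apply: (@le_lt_trans _ _ b%:E); last by rewrite lte_fin.
apply: ge_ereal_sup => _ [theta Htheta <-].
apply: le_trans (measure_le_integral
  (h := fun x => expR (- S x) * expR t) _ _ _ _ _) _ => //.
- by apply: measurable_funM => //; exact: mexp.
- move=> x /= /negbT; rewrite -ltNge => St.
  by rewrite -expRD -[leLHS]expR0 ler_expR addrC subr_ge0 ltW.
under eq_integral do rewrite EFinM.
rewrite ge0_integralZr//.
- apply: (@le_trans _ _ ((b * expR (- t))%:E * (expR t)%:E)%E).
    by apply: lee_wpmul2r; [rewrite lee_fin expR_ge0|exact: H1].
  by rewrite -EFinM -mulrA -expRD addNr expR0 mulr1.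
- by apply/measurable_EFinP; exact: mexp.
Qed.

Lemma expR_le_invr (R : realType) (y : R) : y < 1 -> expR y <= (1 - y)^-1.
Proof.
move=> y1; rewrite -[leLHS]invrK -expRN lef_pV2 ?posrE ?expR_gt0 ?subr_gt0//.
exact: expR_ge1Dx.
Qed.

(** It suffices that (1 - u) (1 + u + 2 u^2) >= 1, which needs u <= 1/2. *)
Lemma expR_le_subr (R : realType) (u : R) : 0 <= u <= 1 / 2 ->
  expR (- u - 2 * u ^+ 2) <= 1 - u.
Proof.
move=> /andP[u0 u1]; apply: le_trans (expR_le_invr _) _; first by nra.
by rewrite invf_ple ?posrE; [rewrite -div1r ler_pdivrMr; nra|nra|lra].
Qed.

(** It suffices that (1 + u) (1 - u + u^2) = 1 + u^3 is at least 1. *)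
Lemma expR_le_addr (R : realType) (u : R) : 0 <= u ->
  expR (u - u ^+ 2) <= 1 + u.
Proof.
move=> u0; apply: le_trans (expR_le_invr _) _; first by nra.
have h : 0 < 1 - (u - u ^+ 2) by nra.
rewrite -div1r ler_pdivrMr//.
have := mulr_ge0 u0 (sqr_ge0 u); nra.
Qed.

Lemma sqrt_exp_inv_le (R : realType) (d : nat) (y z : R) : expR z <= y ->
  Num.sqrt y ^- d <= expR (- (z / 2 * d%:R)).
Proof.
move=> zy; have y0 : 0 < y by exact: lt_le_trans (expR_gt0 _) zy.
rewrite expRN lef_pV2 ?posrE ?expR_gt0 ?exprn_gt0 ?sqrtr_gt0//.
rewrite mulrC expRM_natl; apply: lerXn2r; rewrite ?nnegrE ?expR_ge0 ?sqrtr_ge0//.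
have -> : expR (z / 2) = Num.sqrt (expR z).
  by rewrite [in RHS](splitr z) expRD -expr2 sqrtr_sqr gtr0_norm ?expR_gt0.
exact: ler_wsqrtr.
Qed.

(** With |q|^2 <= <q, theta> on the alternative, the likelihood ratio of N(q/2, I/n)
against the null separates: half of the mean shift is kept as a margin, which
leaves exp (- n |q|^2 / 4) / alpha for the second error. *)
Lemma testable_linear (R : realType) d m (thetahat : 'I_m -> 'cV[R]_d)
    (r : 'I_m -> R) n (epsilon alpha beta : R) (q : 'cV[R]_d) :
  0 < alpha < 1 -> 0 < beta < 1 -> (0 < n)%N ->
  (forall theta, alternative thetahat r epsilon theta -> dot q q <= dot q theta) ->
  6 * (1 - ln (alpha * beta)) <= n%:R * dot q q ->
  testable thetahat r n epsilon alpha beta.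
Proof.
move=> /andP[a0 a1] /andP[b0 b1] n0 Hq nq.
have N0 : 0 < n%:R :> R by rewrite ltr0n.
have ab0 : 0 < alpha * beta by exact: mulr_gt0.
have l0 : ln (alpha * beta) < 0 by rewrite ln_lt0// ab0/= mulr_ilt1// ltW.
pose eta := 2^-1 *: q.
apply: (@testable_of_chernoff _ _ _ _ _ _ _ _ _ (fun x => n%:R * dot eta x)
  (n%:R / 2 * dot eta eta - ln alpha) (expR (- (n%:R * dot q q / 4)) / alpha)).
- by apply: measurable_funM => //; exact: measurable_dot.
- rewrite ltr_pdivrMr// (mulrC beta) -[ltRHS]lnK ?posrE// ltr_expR; lra.
- rewrite gauss_mgf_linear// dot0r mulr0 add0r expRD expRN lnK ?posrE//.
  by rewrite mulrCA divff ?gt_eqF// mulr1.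
- move=> theta /Hq Hth.
  under eq_integral do rewrite -mulrN -dotNl.
  rewrite gauss_mgf_linear// lee_fin opprB [X in _ <= _ * X]expRD lnK ?posrE//.
  rewrite mulrA divfK ?gt_eqF// -expRD ler_expR.
  by rewrite /eta !(dotNl, dotNr, dotZl, dotZr); nra.
Qed.

(** The exponent u = 1 / (2 sqrt d) balances the two error terms: the fluctuation of
n |x|^2 around d is of order sqrt d, so that d u^2 stays bounded while
u n |theta|^2 is of order n |theta|^2 / sqrt d. *)
Lemma testable_chi2 (R : realType) d m (thetahat : 'I_m -> 'cV[R]_d)
    (r : 'I_m -> R) n (epsilon alpha beta : R) :
  0 < alpha < 1 -> 0 < beta < 1 -> (0 < n)%N -> (0 < d)%N ->
  (forall theta, alternative thetahat r epsilon theta ->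
    6 * (1 - ln (alpha * beta)) * Num.sqrt d%:R <= n%:R * dot theta theta) ->
  testable thetahat r n epsilon alpha beta.
Proof.
move=> /andP[a0 a1] /andP[b0 b1] n0 d0 Halt.
have N0 : 0 < n%:R :> R by rewrite ltr0n.
have ab0 : 0 < alpha * beta by exact: mulr_gt0.
set D := Num.sqrt d%:R in Halt.
have D1 : 1 <= D by rewrite -sqrtr1 ler_wsqrtr// ler1n.
have D2 : d%:R = D ^+ 2 by rewrite sqr_sqrtr.
pose u := (2 * D)^-1.
have uD : u * D = 2^-1 by rewrite /u invfM -mulrA mulVf ?mulr1// gt_eqF//; lra.
have u0 : 0 < u by rewrite invr_gt0; lra.
have u1 : u <= 1 / 2 by nra.
have ud : u * d%:R = D / 2 by rewrite D2 expr2 mulrA uD mulrC.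
have uud : u ^+ 2 * d%:R = 4^-1.
  by rewrite expr2 -mulrA ud mulrA uD; field.
(* The threshold makes the first error at most alpha: 4^-1 comes from
   d u^2 and D / 4 from d u / 2. *)
apply: (@testable_of_chernoff _ _ _ _ _ _ _ _ _
  (fun x => n%:R / 2 * u * dot x x)
  (D / 4 + 4^-1 - ln alpha) (beta * expR (- (5 / 8)))).
- by apply: measurable_funM => //; exact: measurable_dot2.
- by rewrite gtr_pMr// -[ltRHS]expR0 ltr_expR; lra.
- rewrite gauss_mgf_quadratic//; last by lra.
  rewrite dot0r mulr0 expR0 mulr1 lee_fin.
  have /expR_le_subr/(sqrt_exp_inv_le d) H : 0 <= u <= 1 / 2 by rewrite ltW.
  apply: le_trans H _.
  rewrite expRD [in leRHS]expRN lnK ?posrE// [in leRHS]mulrCA divff ?gt_eqF// mulr1 ler_expR.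
  by nra.
- move=> theta /Halt Hth.
  under eq_integral do rewrite -mulNr -mulrN.
  rewrite gauss_mgf_quadratic//; last by lra.
  rewrite opprK lee_fin.
  have /(sqrt_exp_inv_le d) H := @expR_le_addr _ u (ltW u0).
  apply: le_trans (ler_wpM2r (expR_ge0 _) H) _.
  have -> : beta = expR (ln (alpha * beta)) * expR (- ln alpha).
    by rewrite expRN !lnK ?posrE// mulrAC divff ?mul1r// gt_eqF.
  rewrite -!expRD ler_expR.
  have -> : n%:R / 2 * (- u / (1 + u)) * dot theta theta =
      - (n%:R * dot theta theta) * (u / (2 * (1 + u))).
    by field; lra.
  have u3 : u / 3 <= u / (2 * (1 + u)).
    by rewrite ler_pM2l// lef_pV2 ?posrE; lra.
  have : n%:R * dot theta theta * (u / 3) <=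
      n%:R * dot theta theta * (u / (2 * (1 + u))).
    by apply: ler_wpM2l => //; rewrite mulr_ge0 ?dot_ge0// ltW.
  have : (1 - ln (alpha * beta)) <= n%:R * dot theta theta * (u / 3).
    have -> : 1 - ln (alpha * beta) = 6 * (1 - ln (alpha * beta)) * D * (u / 3).
      transitivity (2 * (1 - ln (alpha * beta)) * (u * D)); last by field.
      by rewrite uD; field.
    by apply: ler_wpM2r => //; lra.
  lra.
Qed.

(** * Geometry of the alternative *)

Lemma dotE (R : realType) d (u v : 'cV[R]_d) : dot u v = (u^T *m v) ord0 ord0.
Proof. by rewrite mxE; apply: eq_bigr => i _; rewrite mxE. Qed.

(** Gram-Schmidt: as long as fewer than d - rank U vectors have been chosen, the
kernel of U together with them is nonzero. *)
Lemma orthonormal_complement (R : realType) d m (U : 'M[R]_(d, m)) k :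
  (k + \rank U <= d)%N ->
  exists W : 'M[R]_(k, d), W *m W^T = 1%:M /\ W *m U = 0.
Proof.
elim: k => [|k IH] kU; first by exists 0; split; [apply/matrixP => -[]|exact: mul0mx].
have [W [WW WU]] := IH (ltnW kU).
have : (kermx (row_mx U W^T) != 0).
  rewrite -mxrank_eq0 mxrank_ker subn_eq0 -ltnNge.
  apply: leq_ltn_trans (_ : (\rank U + k < d)%N); last by rewrite addnC.
  rewrite -mxrank_tr tr_row_mx -addsmxE (leq_trans (mxrank_adds_leqif _ _).1)//.
  by rewrite mxrank_tr trmxK leq_add2l rank_leq_row.
move=> /rowV0Pn[v /sub_kermxP]; rewrite mul_mx_row -row_mx0 => /eq_row_mx[vU vW] v0.
pose N := dot v^T v^T.
have N0 : 0 < N by rewrite lt_neqAle dot_ge0 eq_sym dot_eq0 trmx_eq0 v0.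
pose w := (Num.sqrt N)^-1 *: v.
have ww : w *m w^T = 1%:M.
  apply/matrixP => i j; rewrite !ord1 -{1}(trmxK w) -dotE mxE eqxx.
  rewrite linearZ/= dotZl dotZr -/N mulrA -invfM -expr2 sqr_sqrtr ?ltW//.
  by rewrite mulVf ?gt_eqF.
have wW : w *m W^T = 0 by rewrite -scalemxAl vW scaler0.
have Ww : W *m w^T = 0 by apply: trmx_inj; rewrite trmx_mul trmxK trmx0.
have cWW : col_mx w W *m (col_mx w W)^T = 1%:M.
  by rewrite tr_col_mx mul_col_row WW ww wW Ww -scalar_mx_block.
have cWU : col_mx w W *m U = 0.
  by rewrite mul_col_mx WU -scalemxAl vU scaler0 col_mx0.
by exists (col_mx w W).
Qed.

Lemma dot_mulmx_tr (R : realType) d k (W : 'M[R]_(k, d)) (s t : 'cV[R]_k) :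
  W *m W^T = 1%:M -> dot (W^T *m s) (W^T *m t) = dot s t.
Proof.
move=> WW; rewrite !dotE trmx_mul trmxK -mulmxA (mulmxA W) WW mul1mx.
by [].
Qed.

Lemma col_proj_unique (R : realType) d m (U : 'M[R]_(d, m)) (theta : 'cV[R]_d) w :
  U^T *m (theta - U *m w) = 0 -> col_proj U theta = U *m w.
Proof.
move=> Hw; have [w' pE] := col_proj_sub U theta.
have := col_proj_orthogonal U theta; rewrite pE => Hw'.
apply/eqP; rewrite -subr_eq0 -dot_eq0 dotE -mulmxBr trmx_mul -mulmxA mulmxBr.
have -> : U *m w' - U *m w = (theta - U *m w) - (theta - U *m w').
  by rewrite opprB [RHS]addrC addrA subrK.
by rewrite mulmxBr Hw Hw' subrr mulmx0 mxE.
Qed.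

Lemma dot_col_proj (R : realType) d m (U : 'M[R]_(d, m)) (theta z : 'cV[R]_d) :
  U^T *m z = 0 -> dot (col_proj U theta) z = 0.
Proof.
move=> Uz; have [w ->] := col_proj_sub U theta.
by rewrite dotE trmx_mul -mulmxA Uz mulmx0 mxE.
Qed.

(** Pythagoras' theorem for the projection. *)
Lemma dot_sqr_col_proj (R : realType) d m (U : 'M[R]_(d, m)) (theta : 'cV[R]_d) :
  dot theta theta = dot (col_proj U theta) (col_proj U theta) +
    dot (theta - col_proj U theta) (theta - col_proj U theta).
Proof.
have dot_add (z p : 'cV[R]_d) :
    dot p z = 0 -> dot (z + p) (z + p) = dot p p + dot z z.
  by move=> pz; rewrite dotDl !dotDr (dotC z p) pz; ring.
rewrite -{1 2}(subrK (col_proj U theta) theta) [LHS]dot_add//.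
by apply: dot_col_proj; exact: col_proj_orthogonal.
Qed.

(** Uhat has the normalised predictions as columns, so its left kernel is orthogonal
to the predictions themselves; a zero prediction is orthogonal to everything. *)
Lemma dot_thetahat (R : realType) d m (thetahat : 'I_m -> 'cV[R]_d) (z : 'cV[R]_d) i :
  (Uhat thetahat)^T *m z = 0 -> dot (thetahat i) z = 0.
Proof.
move=> Uz; have [->|t0] := eqVneq (thetahat i) 0; first by rewrite dotC dot0r.
have n0 : norm2 (thetahat i) != 0 by rewrite -sqrf_eq0 norm2_sqr dot_eq0.
have := congr1 (fun M : 'cV[R]_m => M i ord0) Uz; rewrite !mxE.
under eq_bigr do rewrite !mxE -mulrA.
by rewrite -mulr_sumr => /eqP; rewrite mulf_eq0 invr_eq0 (negbTE n0)/= => /eqP.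
Qed.

Lemma dot_thetahat_col_proj (R : realType) d m (thetahat : 'I_m -> 'cV[R]_d)
    (theta : 'cV[R]_d) i :
  dot (thetahat i) (col_proj (Uhat thetahat) theta) = dot (thetahat i) theta.
Proof.
rewrite -[in RHS](subrK (col_proj (Uhat thetahat) theta) theta) dotDr.
by rewrite [X in _ = X + _]dot_thetahat ?add0r//; exact: col_proj_orthogonal.
Qed.

(** Expanding the square: for a fixed norm, the balls are half-spaces whose normals
are the predictions. *)
Lemma ballsP (R : realType) d m (thetahat : 'I_m -> 'cV[R]_d) (r : 'I_m -> R) theta :
  (forall i, 0 <= r i) ->
  balls thetahat r theta <->
  forall i, dot theta theta + dot (thetahat i) (thetahat i) - r i ^+ 2 <=
            2 * dot (thetahat i) theta.
Proof.
move=> r0; rewrite /balls/=.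
have E i : dot (theta - thetahat i) (theta - thetahat i) =
    dot theta theta + dot (thetahat i) (thetahat i) - 2 * dot (thetahat i) theta.
  by rewrite !(dotDl, dotDr, dotNl, dotNr) (dotC theta (thetahat i)); ring.
split=> H i; have := H i; rewrite norm2_le// E; lra.
Qed.

(** A nonempty polyhedron has a point of least norm, by compactness, and convexity
turns its minimality into a separation of the polyhedron from the origin. *)
Lemma min_norm_point (R : realType) d m (a : 'I_m -> 'cV[R]_d) (b : 'I_m -> R)
    (theta0 : 'cV[R]_d) : (forall i, b i <= dot (a i) theta0) ->
  exists q, [/\ forall i, b i <= dot (a i) q, dot q q <= dot theta0 theta0 &
    forall theta, (forall i, b i <= dot (a i) theta) -> dot q q <= dot q theta].
Proof.
move=> H0; pose K := [set theta : 'cV[R]_d | forall i, b i <= dot (a i) theta].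
have csum (F : 'I_d -> 'rV[R]_d -> R) : (forall i, continuous (F i)) ->
    continuous (fun v => \sum_i F i v).
  by move=> cF; apply: continuous_big => //; exact: add_continuous.
have cdot (u : 'cV[R]_d) : continuous (fun v : 'rV[R]_d => dot u v^T).
  apply: csum => i v.
  rewrite (_ : (fun _ => _) = (fun v : 'rV[R]_d => u i ord0 * v ord0 i)).
    by apply: continuousM; [exact: cst_continuous|exact: coord_continuous].
  by apply/funext => w; rewrite mxE.
have cdot2 : continuous (fun v : 'rV[R]_d => dot v^T v^T).
  apply: csum => i v.
  rewrite (_ : (fun _ => _) = (fun v : 'rV[R]_d => v ord0 i * v ord0 i)).
    by apply: continuousM; exact: coord_continuous.
  by apply/funext => w; rewrite mxE.
pose A := [set v : 'rV[R]_d | dot v^T v^T <= dot theta0 theta0] `&`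
  \bigcap_i [set v : 'rV[R]_d | b i <= dot (a i) v^T].
have AE v : A v <-> dot v^T v^T <= dot theta0 theta0 /\ K v^T.
  by split=> -[v1 v2]; split => // i; [exact: (v2 i)|move=> _; exact: v2].
have cA : closed A.
  apply: closedI.
    by apply: (preimage_closed (D := [set x | x <= _])) => [v _|];
      [exact: cdot2|exact: closed_le].
  apply: closed_bigI => i _.
  by apply: (preimage_closed (D := [set x | _ <= x])) => [v _|];
    [exact: cdot|exact: closed_ge].
have bA : bounded_set A.
  exists (1 + dot theta0 theta0); split; first exact: num_real.
  move=> M HM v [/= Hv _].
  rewrite /Num.norm/= mx_normrE; apply/bigmax_leP; split.
    by have := dot_ge0 theta0; lra.
  move=> [i j] _ /=; rewrite (ord1 i).
  have : v ord0 j ^+ 2 <= dot v^T v^T.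
    rewrite /dot (bigD1 j)//= !mxE -expr2 lerDl; apply: sumr_ge0 => k _.
    by rewrite -expr2 sqr_ge0.
  by rewrite -real_normK ?num_real//; nra.
have A0 : A !=set0 by exists theta0^T; apply/AE; rewrite trmxK.
have [||w wA wmin] := @EVT_min_rV R d (fun v => dot v^T v^T) A A0.
- exact: bounded_closed_compact.
- exact: continuous_subspaceT.
have /AE[w1 w2] : A w by rewrite -in_setE.
set q := w^T in w1 w2 wmin.
have qmin theta : K theta -> dot q q <= dot theta theta.
  move=> Ht; have [h|/ltW h] := leP (dot theta theta) (dot theta0 theta0).
    by have := wmin theta^T; rewrite trmxK; apply; rewrite inE; apply/AE; rewrite trmxK.
  exact: le_trans h.
exists q; split => // theta Kt.
rewrite leNgt; apply/negP => Hlt.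
set c := dot q theta - dot q q.
have c0 : c < 0 by rewrite subr_lt0.
set D := dot (theta - q) (theta - q).
have D0 : 0 <= D by exact: dot_ge0.
(* |q + t (theta - q)|^2 = |q|^2 + t (2 c + t D), and this t keeps t D <= - c,
   so that the norm would decrease. *)
pose t := - c / (D - c).
have Dc : 0 < D - c by lra.
have t0 : 0 < t by rewrite divr_gt0//; lra.
have t1 : t <= 1 by rewrite ler_pdivrMr//; lra.
have tD : t * D <= - c by rewrite mulrAC ler_pdivrMr//; nra.
have : K (q + t *: (theta - q)).
  move=> i; rewrite dotDr dotZr dotDr dotNr.
  have := Kt i; have := w2 i; nra.
move=> /qmin.
have -> : dot (q + t *: (theta - q)) (q + t *: (theta - q)) =
    dot q q + t * (2 * c + t * D).
  rewrite /c /D !(dotDl, dotDr, dotZl, dotZr, dotNl, dotNr) (dotC theta q).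
  by ring.
nra.
Qed.

(** The point of least norm q of the polyhedron of the linearised constraints.
Projecting q on the span of the predictions changes none of these constraints,
and adding a multiple of a unit vector orthogonal to the span reaches the norm
e, so the projection of q competes in the infimum that defines gamma2. *)
Lemma alternative_separated (R : realType) d m (thetahat : 'I_m -> 'cV[R]_d)
    (r : 'I_m -> R) (e : R) : 0 <= e -> (forall i, 0 <= r i) ->
  (\rank (Uhat thetahat) < d)%N -> sphere e `&` balls thetahat r !=set0 ->
  exists q, (gamma2 thetahat r e <= (dot q q)%:E)%E /\
    forall theta, alternative thetahat r e theta -> dot q q <= dot q theta.
Proof.
move=> e0 r0 rk [theta1 [S1 B1]]; set U := Uhat thetahat in rk.
have halfspace theta : alternative thetahat r e theta -> forall i,
    e ^+ 2 + dot (thetahat i) (thetahat i) - r i ^+ 2 <= dot (2 *: thetahat i) theta.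
  move=> [/= H1 /ballsP H2] i; have {H2} := H2 r0 i; rewrite dotZl.
  have : e ^+ 2 <= dot theta theta by rewrite -norm2_sqr lerXn2r ?nnegrE ?norm2_ge0.
  lra.
have [|q [Kq qle qmin]] := @min_norm_point R d m (fun i => 2 *: thetahat i)
    (fun i => e ^+ 2 + dot (thetahat i) (thetahat i) - r i ^+ 2) theta1.
  by apply: halfspace; split => //=; rewrite (S1 : norm2 theta1 = e).
exists q; split; last by move=> theta /halfspace/qmin.
set p := col_proj U q.
have pyth : dot q q = dot p p + dot (q - p) (q - p) := dot_sqr_col_proj U q.
have pq : dot p p <= dot q q by rewrite pyth lerDl dot_ge0.
have qe : dot q q <= e ^+ 2.
  by apply: le_trans qle _; rewrite -norm2_sqr (S1 : norm2 theta1 = e).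
have [W [WW WU]] := orthonormal_complement (U := U) (k := 1) rk.
have UW : U^T *m W^T = 0 by rewrite -trmx_mul WU trmx0.
pose z := Num.sqrt (e ^+ 2 - dot p p) *: W^T.
have Uz : U^T *m z = 0 by rewrite -scalemxAr UW scaler0.
have pz : dot p z = 0 by exact: dot_col_proj.
have zz : dot z z = e ^+ 2 - dot p p.
  rewrite dotZl dotZr (dotE W^T) trmxK WW mxE mulr1 -expr2 sqr_sqrtr//; lra.
have tt : dot (p + z) (p + z) = e ^+ 2.
  by rewrite dotDl !dotDr (dotC z p) pz zz; ring.
have projE : col_proj U (p + z) = p.
  have [w wE] := col_proj_sub U q.
  by rewrite /p wE; apply: col_proj_unique; rewrite -wE addrC addKr.
apply: le_trans (_ : ((norm2 p ^+ 2)%:E <= _)%E); last by rewrite lee_fin norm2_sqr.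
apply: ereal_inf_lbound; exists (p + z); last by rewrite projE.
split.
  by apply/eqP; rewrite -(@eqrXn2 _ 2) ?norm2_ge0//; rewrite norm2_sqr tt.
apply/ballsP => // i; rewrite tt.
have := Kq i; rewrite dotZl.
rewrite -(dot_thetahat_col_proj thetahat q) -/U -/p.
by rewrite dotDr (dot_thetahat i Uz) addr0.
Qed.

(** The infimum is over a nonempty set of nonnegative reals. *)
Lemma gamma2_fin (R : realType) d m (thetahat : 'I_m -> 'cV[R]_d)
    (r : 'I_m -> R) (e : R) : sphere e `&` balls thetahat r !=set0 ->
  exists2 g : R, 0 <= g & gamma2 thetahat r e = g%:E.
Proof.
move=> [theta Ht].
have lb : (0%:E <= gamma2 thetahat r e)%E.
  by apply: le_ereal_inf_tmp => _ [? _ <-]; rewrite lee_fin sqr_ge0.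
have ub : (gamma2 thetahat r e <= (norm2 (col_proj (Uhat thetahat) theta) ^+ 2)%:E)%E.
  by apply: ereal_inf_lbound; exists theta.
case: (gamma2 thetahat r e) lb ub => [g| |]//= lb _; exists g => //.
Qed.

(** At g = 0 both sides are false, since the inverse is then infinite; this excludes
e = 0 and gamma2 = 0 from the set that defines the rate. *)
Lemma EFin_mul_inv_le (R : realType) (K a g N : R) : 0 < K -> 0 < a -> 0 <= g ->
  (K%:E * (a%:E * (g%:E)^-1) <= N%:E)%E = (0 < g) && (K * a <= N * g).
Proof.
move=> K0 a0; rewrite le_eqVlt => /predU1P[<-|g0].
  by rewrite inver eqxx ltxx gt0_muley ?lte_fin// gt0_muley ?lte_fin.
by rewrite inver gt_eqF// g0/= -!EFinM lee_fin mulrA ler_pdivrMr.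
Qed.

(** * Indistinguishability of sign mixtures *)

(** The likelihood ratio of N(theta, I/n) against N(0, I/n). *)
Definition gauss_lr (R : realType) d (n : nat) (theta x : 'cV[R]_d) : R :=
  expR (n%:R * dot theta x - n%:R / 2 * dot theta theta).

Lemma measurable_gauss_lr (R : realType) d n (theta : 'cV[R]_d) :
  measurable_fun setT (gauss_lr n theta).
Proof.
apply: measurableT_comp => //; apply: measurable_funB => //.
by apply: measurable_funM => //; exact: measurable_dot.
Qed.

Lemma ge0_integral_gauss_lr (R : realType) d n (theta : 'cV[R]_d)
    (g : 'cV[R]_d -> \bar R) : (0 < n)%N ->
  measurable_fun setT g -> (forall x, 0 <= g x)%E ->
  (\int[gauss 0 (Num.sqrt n%:R)^-1]_x (g x * (gauss_lr n theta x)%:E) =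
   \int[gauss theta (Num.sqrt n%:R)^-1]_x g x)%E.
Proof.
move=> n0 mg g0; have := @ge0_integral_gauss_shift R d n 0 theta g n0 mg g0.
rewrite add0r => H; apply/esym; apply: etrans H _.
by apply: eq_integral => x _; rewrite subr0.
Qed.

(** The product of two likelihood ratios is, up to a constant, the likelihood ratio
of the sum of their parameters. *)
Lemma integral_gauss_lrM (R : realType) d n (theta theta' : 'cV[R]_d) : (0 < n)%N ->
  (\int[gauss 0 (Num.sqrt n%:R)^-1]_x (gauss_lr n theta' x * gauss_lr n theta x)%:E
   = (expR (n%:R * dot theta theta'))%:E)%E.
Proof.
move=> n0; under eq_integral do rewrite EFinM.
rewrite ge0_integral_gauss_lr//; last 2 first.
- by apply/measurable_EFinP; exact: measurable_gauss_lr.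
- by move=> x; rewrite lee_fin expR_ge0.
rewrite /gauss_lr; under eq_integral do rewrite expRD EFinM.
rewrite ge0_integralZr//.
- rewrite gauss_mgf_linear// -EFinM -expRD (dotC theta).
  by congr (expR _)%:E; ring.
- apply/measurable_EFinP; apply: measurableT_comp => //.
  by apply: measurable_funM => //; exact: measurable_dot.
Qed.

(** The bound of the power of a test against a mixture by the chi-square divergence.
With L the likelihood ratio of the mixture, the pointwise inequality
  1_A L + t L <= 1_A + t/2 L^2 + t/2 + 1/(2 t),
which for x in A is AM-GM applied to L - 1, is integrated; t replaces the square
root of the Cauchy-Schwarz inequality. *)
Lemma mixture_power_le (R : realType) d n (I : finType) (theta : I -> 'cV[R]_d)
    (A : set 'cV[R]_d) (t : R) : (0 < n)%N -> (0 < #|I|)%N -> 0 < t ->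
  measurable A ->
  #|I|%:R^-1 * \sum_s fine (gauss (theta s) (Num.sqrt n%:R)^-1 A) <=
  fine (gauss 0 (Num.sqrt n%:R)^-1 A) + (2 * t)^-1 +
  t / 2 * (#|I|%:R^-2 * (\sum_s \sum_s' expR (n%:R * dot (theta s) (theta s'))) - 1).
Proof.
move=> n0 I0 t0 mA.
set sg := (Num.sqrt n%:R)^-1; set k : R := #|I|%:R.
have k0 : 0 < k by rewrite ltr0n.
pose L s x := gauss_lr n (theta s) x.
have L0 s x : 0 <= L s x by exact: expR_ge0.
have mL s : measurable_fun setT (L s) by exact: measurable_gauss_lr.
pose C : R := t / 2 + (2 * t)^-1.
have C0 : 0 <= C by rewrite addr_ge0// ?invr_ge0 ?divr_ge0 ?mulr_ge0// ltW.
pose g (x : 'cV[R]_d) : R := k^-1 * (\1_A x + t).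
have mg : measurable_fun setT g.
  by apply: measurable_funM => //; apply: measurable_funD => //; exact: measurable_indic.
have g0 x : 0 <= g x by rewrite mulr_ge0 ?invr_ge0 ?addr_ge0 ?(ltW k0) ?(ltW t0).
have lhsE : (\int[gauss 0 sg]_x (\sum_s g x * L s x)%:E =
    (k^-1 * \sum_s fine (gauss (theta s) sg A) + t)%:E)%E.
  under eq_integral do rewrite -sumEFin.
  rewrite ge0_integral_sum//; last 2 first.
  - by move=> s; apply/measurable_EFinP/measurable_funM.
  - by move=> s x _; rewrite lee_fin mulr_ge0.
  have int_s s : (\int[gauss 0 sg]_x (g x * L s x)%:E =
      (k^-1 * (fine (gauss (theta s) sg A) + t))%:E)%E.
    under eq_integral do rewrite EFinM.
    rewrite ge0_integral_gauss_lr//; last exact/measurable_EFinP.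
    rewrite /g; under eq_integral do rewrite EFinM.
    rewrite ge0_integralZl//; last 3 first.
    + by apply/measurable_EFinP/measurable_funD => //; exact: measurable_indic.
    + by move=> x _; rewrite lee_fin addr_ge0// ltW.
    + by rewrite lee_fin invr_ge0 ltW.
    under eq_integral do rewrite EFinD.
    rewrite ge0_integralD//; last 2 first.
    + by apply/measurable_EFinP; exact: measurable_indic.
    + by move=> x _; rewrite lee_fin ltW.
    rewrite integral_indic// setIT integral_probability_cst.
    by rewrite EFinM EFinD fineK// fin_num_measure.
  under eq_bigr do rewrite int_s.
  rewrite sumEFin -mulr_sumr big_split/= sumr_const -mulr_natl mulrDr.
  by rewrite mulKf// gt_eqF.
have rhsE : (\int[gauss 0 sg]_x ((\1_A x + C) +
      \sum_s \sum_s' t / 2 * k ^- 2 * (L s' x * L s x))%:E =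
    (fine (gauss 0 sg A) + C + t / 2 * (k ^- 2 *
     \sum_s \sum_s' expR (n%:R * dot (theta s) (theta s'))))%:E)%E.
  have mLL s s' : measurable_fun setT (fun x => t / 2 * k ^- 2 * (L s' x * L s x)).
    by apply: measurable_funM => //; exact: measurable_funM.
  have LL0 s s' x : 0 <= t / 2 * k ^- 2 * (L s' x * L s x).
    by rewrite !mulr_ge0 ?invr_ge0 ?exprn_ge0// ltW.
  under eq_integral do rewrite EFinD.
  rewrite ge0_integralD//; last 4 first.
  - by move=> x _; rewrite lee_fin addr_ge0.
  - by apply/measurable_EFinP/measurable_funD => //; exact: measurable_indic.
  - by move=> x _; rewrite lee_fin; do 2 (apply: sumr_ge0 => ? _).
  - by apply/measurable_EFinP; do 2 (apply: measurable_sum => ?).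
  rewrite [RHS]EFinD; congr (_ + _)%E.
    under eq_integral do rewrite EFinD.
    rewrite ge0_integralD//; last by apply/measurable_EFinP; exact: measurable_indic.
    rewrite integral_indic// setIT integral_probability_cst.
    by rewrite [RHS]EFinD fineK// fin_num_measure.
  under eq_integral do rewrite -sumEFin.
  rewrite ge0_integral_sum//; last 2 first.
  - by move=> s; apply/measurable_EFinP; apply: measurable_sum => ?.
  - by move=> s x _; rewrite lee_fin; apply: sumr_ge0 => ? _.
  rewrite !mulr_sumr -sumEFin; apply: eq_bigr => s _.
  under eq_integral do rewrite -sumEFin.
  rewrite ge0_integral_sum//; last 2 first.
  - by move=> s'; apply/measurable_EFinP.
  - by move=> s' x _; rewrite lee_fin.
  rewrite !mulr_sumr -sumEFin; apply: eq_bigr => s' _.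
  under eq_integral do rewrite EFinM.
  rewrite ge0_integralZl//; last 3 first.
  - by apply/measurable_EFinP/measurable_funM.
  - by move=> x _; rewrite lee_fin mulr_ge0.
  - by rewrite lee_fin mulr_ge0 ?divr_ge0 ?invr_ge0 ?exprn_ge0// ltW.
  by rewrite integral_gauss_lrM// -EFinM mulrA.
have : (\int[gauss 0 sg]_x (\sum_s g x * L s x)%:E <=
  \int[gauss 0 sg]_x ((\1_A x + C) +
      \sum_s \sum_s' t / 2 * k ^- 2 * (L s' x * L s x))%:E)%E.
  apply: ge0_le_integral => //.
  - by move=> x _; rewrite lee_fin; apply: sumr_ge0 => s _; rewrite mulr_ge0.
  - by apply/measurable_EFinP; apply: measurable_sum => s; exact: measurable_funM.
  - apply/measurable_EFinP/measurable_funD.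
      by apply: measurable_funD => //; exact: measurable_indic.
    do 2 (apply: measurable_sum => ?).
    by apply: measurable_funM => //; exact: measurable_funM.
  move=> x _; rewrite lee_fin.
  pose l := k^-1 * \sum_s L s x.
  have -> : \sum_s g x * L s x = (\1_A x + t) * l.
    by rewrite -mulr_sumr /g /l; ring.
  have -> : \sum_s \sum_s' t / 2 * k ^- 2 * (L s' x * L s x) = t / 2 * l ^+ 2.
    under eq_bigr do rewrite -mulr_sumr -mulr_suml.
    rewrite -mulr_sumr -mulr_sumr /l exprMn expr2 exprVn; ring.
  have -> : C = (t ^+ 2 + 1) / (2 * t) by rewrite /C; field; rewrite gt_eqF.
  rewrite indicE; case: (x \in A) => /=.
    rewrite -subr_ge0.
    have -> : 1 + (t ^+ 2 + 1) / (2 * t) + t / 2 * l ^+ 2 - (1 + t) * l =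
       (t * (l - 1) - 1) ^+ 2 / (2 * t) by field; rewrite gt_eqF.
    by rewrite divr_ge0 ?sqr_ge0// mulr_ge0// ltW.
  rewrite -subr_ge0.
  have -> : 0 + (t ^+ 2 + 1) / (2 * t) + t / 2 * l ^+ 2 - (0 + t) * l =
       ((t * (l - 1)) ^+ 2 + 1) / (2 * t) by field; rewrite gt_eqF.
  by rewrite divr_ge0 ?addr_ge0 ?sqr_ge0// mulr_ge0// ltW.
rewrite lhsE rhsE lee_fin /C; lra.
Qed.

(** From exp y <= 1 / (1 - y), the left-hand side is at most 2 / (1 - y^2). *)
Lemma cosh_le_expR (R : realType) (y : R) : y ^+ 2 <= 1 / 4 ->
  expR y + expR (- y) <= 2 * expR (2 * y ^+ 2).
Proof.
move=> y2; have y1 : -1 < y < 1 by apply/andP; split; nra.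
have [y1l y1r] := andP y1.
have h1 : expR y <= (1 - y)^-1 by exact: expR_le_invr.
have h2 : expR (- y) <= (1 - - y)^-1 by apply: expR_le_invr; lra.
have h3 : (1 - y)^-1 + (1 - - y)^-1 = 2 * (1 - y ^+ 2)^-1.
  by field; rewrite !gt_eqF//; [nra|lra|lra].
have h4 : (1 - y ^+ 2)^-1 <= 1 + 2 * y ^+ 2.
  rewrite -div1r ler_pdivrMr; last by lra.
  by have := sqr_ge0 y; nra.
have := expR_ge1Dx (2 * y ^+ 2); lra.
Qed.

Definition sign_vec (R : realType) k (s : {ffun 'I_k -> bool}) : 'cV[R]_k :=
  \col_i (-1) ^+ s i.

Lemma dot_sign_vec (R : realType) k (s : {ffun 'I_k -> bool}) :
  dot (sign_vec R s) (sign_vec R s) = k%:R.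
Proof.
rewrite /dot (eq_bigr (fun=> 1)); first by rewrite sumr_const card_ord.
by move=> i _; rewrite !mxE -expr2 sqrr_sign.
Qed.

(** The sum over s' factors over the coordinates, and each factor
exp y + exp (- y) is the same for both values of the sign s i. *)
Lemma sum_expR_sign_vec (R : realType) k (y : R) :
  \sum_(s : {ffun 'I_k -> bool}) \sum_(s' : {ffun 'I_k -> bool})
    expR (y * dot (sign_vec R s) (sign_vec R s')) =
  2 ^+ k * (expR y + expR (- y)) ^+ k.
Proof.
rewrite (eq_bigr (fun=> (expR y + expR (- y)) ^+ k)).
  by rewrite sumr_const card_ffun card_bool card_ord -[LHS]mulr_natl natrX.
move=> s _; pose F i (b : bool) := expR (y * ((-1) ^+ s i * (-1) ^+ b)) : R.
rewrite (eq_bigr (fun s' : {ffun 'I_k -> bool} => \prod_i F i (s' i))).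
  rewrite -(bigA_distr_bigA F) (eq_bigr (fun=> expR y + expR (- y))).
    by rewrite prodr_const card_ord.
  move=> i _; rewrite big_bool /F/=.
  by case: (s i); rewrite ?expr1 ?expr0 ?mulN1r ?mul1r ?opprK ?mulr1 ?mulrN1// addrC.
move=> s' _; rewrite /F -expR_sum -mulr_sumr; congr (expR (_ * _)).
by apply: eq_bigr => i _; rewrite !mxE.
Qed.

(** Here y is n a^2, with k a^2 the squared norm of the random part and D the ambient
dimension.  Squaring the hypothesis gives y^2 k^2 <= c^2 D <= 2 c^2 k. *)
Lemma gram_scale_bound (R : realType) (k : nat) (y D c : R) :
  0 <= y -> (0 < k)%N -> 0 <= D -> D <= 2 * k%:R -> 0 <= c <= 1 / 4 ->
  y * k%:R <= c * Num.sqrt D ->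
  y ^+ 2 <= 1 / 4 /\ y ^+ 2 * k%:R <= 2 * c ^+ 2.
Proof.
move=> y0 k0 D0 Dk /andP[c0 c1] yk.
have k1 : 1 <= k%:R :> R by rewrite ler1n.
have h2 : (y * k%:R) ^+ 2 <= c ^+ 2 * D.
  rewrite -[D]sqr_sqrtr// -exprMn; apply: lerXn2r => //.
    by rewrite nnegrE mulr_ge0// ler0n.
  by rewrite nnegrE mulr_ge0// sqrtr_ge0.
have h1 : c ^+ 2 * D <= c ^+ 2 * (2 * k%:R) by rewrite ler_wpM2l ?sqr_ge0.
have yyk : y ^+ 2 * k%:R <= 2 * c ^+ 2.
  rewrite -(@ler_pM2r _ k%:R) ?ltr0n//.
  have -> : y ^+ 2 * k%:R * k%:R = (y * k%:R) ^+ 2 by ring.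
  by apply: le_trans h2 _; apply: le_trans h1 _; rewrite le_eqVlt mulrCA mulrA eqxx.
split => //; apply: (@le_trans _ _ (y ^+ 2 * k%:R)); first by rewrite ler_peMr ?sqr_ge0.
by apply: le_trans yyk _; clear -c0 c1; nra.
Qed.

(** G is the Gram matrix of the mixture components; its two terms are the fixed part
in the span of the predictions and the random part orthogonal to it. *)
Lemma mixture_second_moment_le (R : realType) k (N b a2 c : R)
    (G : {ffun 'I_k -> bool} -> {ffun 'I_k -> bool} -> R) :
  (forall s s', G s s' = b + a2 * dot (sign_vec R s) (sign_vec R s')) ->
  0 <= c <= 1 / 4 -> N * b <= c ->
  (N * a2) ^+ 2 <= 1 / 4 -> (N * a2) ^+ 2 * k%:R <= 2 * c ^+ 2 ->
  #|{: {ffun 'I_k -> bool}}|%:R^-2 * (\sum_s \sum_s' expR (N * G s s'))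
    <= 1 + 4 * c.
Proof.
move=> GE /andP[c0 c1] Nb yy yyk; rewrite card_ffun card_bool card_ord natrX.
set y := N * a2 in yy yyk.
have -> : (2 ^+ k)^-2 * (\sum_s \sum_s' expR (N * G s s')) =
    expR (N * b) * ((2 ^+ k)^-1 * (expR y + expR (- y)) ^+ k).
  under eq_bigr => s _ do under eq_bigr => s' _ do
    rewrite GE mulrDr mulrA expRD -/y.
  under eq_bigr do rewrite -mulr_sumr.
  rewrite -mulr_sumr sum_expR_sign_vec.
  by field; rewrite expf_neq0.
have : (2 ^+ k)^-1 * (expR y + expR (- y)) ^+ k <= expR (2 * y ^+ 2 * k%:R).
  rewrite ler_pdivrMl ?exprn_gt0// mulrC [2 * _ * _]mulrC expRM_natl -exprMn mulrC.
  by apply: lerXn2r; rewrite ?nnegrE ?addr_ge0 ?mulr_ge0 ?expR_ge0// cosh_le_expR.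
move=> /(ler_wpM2l (expR_ge0 (N * b))) /le_trans; apply.
rewrite -expRD; apply: (@le_trans _ _ (expR (2 * c))).
  by rewrite ler_expR; clear -c0 c1 Nb yyk; nra.
apply: le_trans (expR_le_invr _) _; first by clear -c1; lra.
by rewrite -div1r ler_pdivrMr; clear -c0 c1; nra.
Qed.

(** The choice t = 1 / delta in the mixture bound: each of the two error terms is
then at most delta / 2. *)
Lemma power_gap_contra (R : realType) (alpha beta c M p0 avg : R) :
  let delta := 1 - alpha - beta in
  0 < delta -> 4 * c <= delta ^+ 2 -> M <= 1 + 4 * c -> p0 <= alpha ->
  1 - beta < avg -> avg <= p0 + (2 * delta^-1)^-1 + delta^-1 / 2 * (M - 1) ->
  False.
Proof.
move=> delta delta0 cle HM Hp0 Havg.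
have -> : (2 * delta^-1)^-1 = delta / 2 by field; rewrite gt_eqF.
have : delta^-1 / 2 * (M - 1) <= delta / 2.
  have -> : delta / 2 = delta^-1 / 2 * delta ^+ 2 by field; rewrite gt_eqF.
  by apply: ler_wpM2l; [rewrite divr_ge0 ?invr_ge0 ?ltW|clear -HM cle; lra].
by move: Hp0 Havg; clear; rewrite /delta; lra.
Qed.

(** No averaging is possible for the component of theta in the span of the
predictions, which must itself be undetectable; the orthogonal one is replaced
by a random sign vector in at least d / 2 dimensions. *)
Lemma not_testable (R : realType) d n m (thetahat : 'I_m -> 'cV[R]_d)
    (r : 'I_m -> R) (epsilon alpha beta c : R) (theta : 'cV[R]_d) :
  0 < alpha -> 0 < beta < 1 - alpha -> (0 < d)%N -> (0 < n)%N ->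
  (forall i, 0 <= r i) ->
  (\rank (Uhat thetahat))%:R <= d%:R / 2 :> R ->
  sphere epsilon theta -> balls thetahat r theta ->
  0 < c -> 4 * c <= (1 - alpha - beta) ^+ 2 ->
  n%:R * norm2 (col_proj (Uhat thetahat) theta) ^+ 2 <= c ->
  n%:R * epsilon ^+ 2 <= c * Num.sqrt d%:R ->
  ~ testable thetahat r n epsilon alpha beta.
Proof.
move=> a0 /andP[b0 b1] d0 n0 r0 rk Se Br c0 cle Hp He [psi [[mpsi Hval] Hpow]].
set U := Uhat thetahat in rk Hp; set p := col_proj U theta in Hp.
set delta := 1 - alpha - beta in cle.
have delta0 : 0 < delta by rewrite /delta; lra.
have delta1 : delta < 1 by rewrite /delta; lra.
have c1 : c <= 1 / 4 by nra.
pose k := (d - \rank U)%N.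
have N0 : 0 < n%:R :> R by rewrite ltr0n.
have dR0 : 0 < d%:R :> R by rewrite ltr0n.
have rkd : (\rank U <= d)%N by exact: rank_leq_row.
have kE : k%:R = d%:R - (\rank U)%:R :> R by rewrite natrB.
have dk : d%:R <= 2 * k%:R :> R by rewrite kE; lra.
have k0 : 0 < k%:R :> R by lra.
have [W [WW WU]] : exists W : 'M[R]_(k, d), W *m W^T = 1%:M /\ W *m U = 0.
  by apply: orthonormal_complement; rewrite subnK.
have UW : U^T *m W^T = 0 by rewrite -trmx_mul WU trmx0.
have Up : U^T *m (theta - p) = 0 := col_proj_orthogonal U theta.
pose rho2 := dot (theta - p) (theta - p).
have rho0 : 0 <= rho2 by exact: dot_ge0.
have pyth : dot theta theta = dot p p + rho2 := dot_sqr_col_proj U theta.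
have thE : dot theta theta = epsilon ^+ 2 by rewrite -norm2_sqr Se.
have pp0 := dot_ge0 p.
rewrite norm2_sqr in Hp.
(* A sign vector has squared norm k, so this scale restores the norm of theta. *)
pose a := Num.sqrt (rho2 / k%:R).
have a2 : a ^+ 2 = rho2 / k%:R by rewrite sqr_sqrtr// divr_ge0// ltW.
pose th (s : {ffun 'I_k -> bool}) := p + a *: (W^T *m sign_vec R s).
have dot_th s s' : dot (th s) (th s') =
    dot p p + a ^+ 2 * dot (sign_vec R s) (sign_vec R s').
  have pW v : dot p (W^T *m v) = 0.
    by apply: dot_col_proj; rewrite mulmxA UW mul0mx.
  rewrite /th !(dotDl, dotDr, dotZl, dotZr) pW (dotC _ p) pW dot_mulmx_tr//; ring.
have th_alt s : alternative thetahat r epsilon (th s).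
  have nth2 : dot (th s) (th s) = dot theta theta.
    by rewrite dot_th dot_sign_vec a2 divfK ?gt_eqF// pyth.
  split.
    rewrite /= -(Se : norm2 theta = epsilon).
    by rewrite -(@ler_pXn2r _ 2) ?nnegrE ?norm2_ge0// !norm2_sqr nth2.
  apply/ballsP => // i; have /ballsP := Br => /(_ r0 i); rewrite nth2.
  suff -> : dot (thetahat i) (th s) = dot (thetahat i) theta by [].
  rewrite -(dot_thetahat_col_proj thetahat theta) -/U -/p.
  rewrite /th dotDr dotZr (dot_thetahat (z := W^T *m sign_vec R s)) ?mulr0 ?addr0//.
  by rewrite mulmxA -/U UW mul0mx.
pose A := psi @^-1` [set true].
have mA : measurable A by rewrite -[X in measurable X]setTI; exact: mpsi.
set P := fun th => fine (gauss th (Num.sqrt n%:R)^-1 A).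
have PA : P 0 <= alpha.
  by rewrite -lee_fin fineK ?fin_num_measure.
have Pth s : 1 - beta < P (th s).
  have : (gauss (th s) (Num.sqrt n%:R)^-1 (psi @^-1` [set false]) < beta%:E)%E.
    by apply: le_lt_trans Hpow; apply: ereal_sup_ubound; exists (th s).
  have -> : psi @^-1` [set false] = ~` A.
    by apply/seteqP; split => x /=; rewrite /A/=; case: (psi x).
  rewrite probability_setC// -(@fineK _ (gauss _ _ A)) ?fin_num_measure//.
  rewrite -EFinB lte_fin ltrBlDr addrC -ltrBlDr; exact.
have I0 : (0 < #|{: {ffun 'I_k -> bool}}|)%N.
  by rewrite card_ffun card_bool expn_gt0.
have cardI : #|{: {ffun 'I_k -> bool}}|%:R = 2 ^+ k :> R.
  by rewrite card_ffun card_bool card_ord natrX.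
have := mixture_power_le th n0 I0 (_ : 0 < delta^-1) mA.
rewrite invr_gt0 => /(_ delta0).
set M := (X in _ <= _ + _ / _ * (X - 1)).
have HM : M <= 1 + 4 * c.
  have yk : n%:R * a ^+ 2 * k%:R <= c * Num.sqrt d%:R.
    rewrite a2 -mulrA divfK ?gt_eqF//; apply: le_trans He.
    by rewrite ler_wpM2l ?ler0n// -thE pyth lerDr.
  have [] := gram_scale_bound _ _ _ dk _ yk.
  - by rewrite mulr_ge0 ?sqr_ge0 ?ler0n.
  - by rewrite -(ltr0n R).
  - exact: ltW.
  - by rewrite ltW.
  by move=> h1 h2; apply: mixture_second_moment_le dot_th _ Hp h1 h2; rewrite ltW.
rewrite cardI.
have Hlow : 1 - beta < (2 ^+ k)^-1 * \sum_s P (th s).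
  rewrite ltr_pdivlMl ?exprn_gt0//.
  have : \sum_(s : {ffun 'I_k -> bool}) (1 - beta) < \sum_s P (th s).
    apply: ltr_sum => [|s _]; last exact: Pth.
    by apply/hasP; exists [ffun=> true]; rewrite ?mem_index_enum.
  by rewrite sumr_const -[X in X < _ -> _]mulr_natl cardI.
exact: power_gap_contra delta0 cle HM PA Hlow.
Qed.

(** * The detection rate *)

Theorem theorem2 (R : realType) (alpha beta : R) :
  0 < alpha < 1 -> 0 < beta < 1 - alpha ->
  exists C1 C2 c1 c2 : R,
    [/\ 0 < C1, 0 < C2, 0 < c1 & 0 < c2] /\
    forall (d n m : nat) (thetahat : 'I_m -> 'cV[R]_d) (r : 'I_m -> R)
           (epsilon : R),
      (0 < d)%N -> (0 < n)%N -> (0 < m)%N ->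
      (forall i, thetahat i != 0) ->
      (forall i, 0 <= r i) ->
      0 < epsilon ->
      (\rank (Uhat thetahat))%:R <= d%:R / 2 :> R ->
      sphere epsilon `&` balls thetahat r !=set0 ->
      ((C1%:E * rate_inf thetahat r n C2 <= epsilon%:E)%E ->
         testable thetahat r n epsilon alpha beta) /\
      (testable thetahat r n epsilon alpha beta ->
         (c1%:E * rate_inf thetahat r n c2 <= epsilon%:E)%E).
Proof.
move=> Ha Hb; have /andP[a0 a1] := Ha; have /andP[b0 b1] := Hb.
have Hb' : 0 < beta < 1 by rewrite b0/=; lra.
have ab0 : 0 < alpha * beta by exact: mulr_gt0.
have l0 : ln (alpha * beta) < 0.
  by rewrite ln_lt0// ab0/= mulr_ilt1// ?ltW//; case/andP: Hb'.
(* K serves both tests, and c makes the excess second moment 4 c equal to the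
   square of the gap 1 - alpha - beta. *)
pose K := 6 * (1 - ln (alpha * beta)); pose c := (1 - alpha - beta) ^+ 2 / 4.
have K0 : 0 < K by rewrite /K; lra.
have c0 : 0 < c by rewrite /c divr_gt0// exprn_gt0//; lra.
exists 2, K, 1, c; split; first by split.
move=> d n m thetahat r epsilon d0 n0 _ _ r0 eps0 rk SB.
have N0 : 0 < n%:R :> R by rewrite ltr0n.
have D0 : 0 < Num.sqrt d%:R :> R by rewrite sqrtr_gt0 ltr0n.
have rkd : (\rank (Uhat thetahat) < d)%N.
  have dR0 : 0 < d%:R :> R by rewrite ltr0n.
  by rewrite -(ltr_nat R); apply: le_lt_trans rk _; lra.
split.
  move=> Hrate.
  have : (rate_inf thetahat r n K < epsilon%:E)%E.
    rewrite ltNge; apply/negP => /(lee_wpmul2l (_ : 0 <= 2%:E)%E).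
    rewrite lee_fin ler0n => /(_ isT) H.
    by have := le_trans H Hrate; rewrite -EFinM lee_fin; lra.
  (* Any C1 > 1 provides an admissible radius e below epsilon, and the alternative
     for epsilon is contained in the one for e. *)
  move=> /ereal_inf_lt[_ [e [e0 He SBe] <-]]; rewrite lte_fin => ee.
  have sub theta : alternative thetahat r epsilon theta -> alternative thetahat r e theta.
    by move=> [/= h1 h2]; split => //=; exact: le_trans (ltW ee) h1.
  have [g g0 gE] := gamma2_fin SBe; rewrite gE in He.
  have [h|h] := leP (g%:E^-1)%E ((Num.sqrt d%:R)%:E * (e ^+ 2)%:E^-1)%E.
    rewrite (min_idPl h) -[X in (K%:E * X)%E]mul1e EFin_mul_inv_le// mulr1 in He.
    have /andP[_ Kg] := He.
    have [q []] := alternative_separated e0 r0 rkd SBe.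
    rewrite gE lee_fin => gq Hq; apply: (@testable_linear _ _ _ _ _ _ _ _ _ q) => //.
      by move=> theta /sub/Hq.
    by apply: le_trans Kg _; rewrite ler_wpM2l ?ler0n.
  rewrite (min_idPr (ltW h)) EFin_mul_inv_le ?sqr_ge0// in He.
  have /andP[_ Ke] := He.
  apply: testable_chi2 => // theta /sub[/= H1 _]; apply: le_trans Ke _.
  by rewrite ler_wpM2l ?ler0n// -norm2_sqr lerXn2r ?nnegrE ?norm2_ge0.
(* It suffices that epsilon itself be admissible in the rate. *)
move=> Htest; rewrite mul1e; apply: ereal_inf_lbound; exists epsilon => //.
split => //; first exact: ltW.
rewrite leNgt; apply/negP => Hlt.
have [g g0 gE] := gamma2_fin SB; rewrite gE in Hlt.
have [theta [St Bt] Hg] : exists2 theta, (sphere epsilon `&` balls thetahat r) theta &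
    n%:R * norm2 (col_proj (Uhat thetahat) theta) ^+ 2 <= c.
  have : (gamma2 thetahat r epsilon < (c / n%:R)%:E)%E.
    rewrite gE lte_fin ltr_pdivlMr//.
    have : (n%:R%:E < c%:E * (1%:E * g%:E^-1))%E.
      apply: lt_le_trans Hlt _; rewrite mul1e.
      by apply: lee_wpmul2l; [rewrite lee_fin ltW|rewrite ge_min lexx].
    rewrite ltNge EFin_mul_inv_le// mulr1 negb_and -leNgt -ltNge.
    move=> /orP[gle|]; last by rewrite mulrC.
    by apply: le_lt_trans c0; rewrite mulr_le0_ge0// ?ler0n.
  move=> /ereal_inf_lt[_ [theta Ht <-]]; rewrite lte_fin ltr_pdivlMr// => h.
  by exists theta => //; rewrite mulrC ltW.
have He : n%:R * epsilon ^+ 2 <= c * Num.sqrt d%:R.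
  have : (n%:R%:E < c%:E * ((Num.sqrt d%:R)%:E * (epsilon ^+ 2)%:E^-1))%E.
    apply: lt_le_trans Hlt _.
    by apply: lee_wpmul2l; [rewrite lee_fin ltW|rewrite ge_min lexx orbT].
  by rewrite ltNge EFin_mul_inv_le ?sqr_ge0// exprn_gt0//= -ltNge => /ltW.
have cle : 4 * c <= (1 - alpha - beta) ^+ 2 by rewrite /c; lra.
exact: (not_testable a0 Hb d0 n0 r0 rk St Bt c0 cle Hg He Htest).
Qed.
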